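(* Let $r$ be continuous and let $f$ be a nontrivial real solution of $f''(x)+r(x)f(x)=0$. Let $n\in\mathbb{N}$, $n\ge 1$, let $i$ be an integer, and let $$z'_i<z_i<z'_{i+1}<z_{i+1}<\cdots<z'_{i+n}<z_{i+n}<z'_{i+n+1},$$ where $z'_i,\dots,z'_{i+n+1}$ are all the zeros of $f'$ and $z_i,\dots,z_{i+n}$ are all the zeros of $f$ in the interval $\mathcal J'=[z'_i,z'_{i+n+1}]$. Suppose $r(x)>0$ for all $x\in\mathcal J'$, and that $r$ is differentiable on $\mathcal J'$. For $x\in\mathcal J'$ put $$S_{-1}(x)=x+\frac{\pi}{2\sqrt{r(x)}},\qquad S_{1}(x)=x-\frac{\pi}{2\sqrt{r(x)}},$$ and let $S^{N}_{\pm1}$ denote the $N$-fold composition of $S_{\pm 1}$ with itself ($S^0_{\pm1}$ being the identity). (1) If $r'(x)<0$ in $\mathcal J'$, then for each $k=i,i+1,\dots,i+n-1$ there exists a non-negative integer $N_k$ such that $$S_{-1}^{N_k}\!\left(z_k+\frac{\pi}{\sqrt{r(z_k)}}\right)\in(z'_{k+1},z_{k+1}).$$ (2) If $r'(x)>0$ in $\mathcal J'$, then for each $j=i+n,i+n-1,\dots,i+1$ there exists a non-negative integer $N_j$ such that $$S_{1}^{N_j}\!\left(z_j-\frac{\pi}{\sqrt{r(z_j)}}\right)\in(z_{j-1},z'_{j}).$$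
   Context: All functions are real-valued; $r$ is continuous on an open interval $D\subseteq\mathbb{R}$ containing $\mathcal J'$, and $f$ is a not identically zero solution on $D$ of $f''+rf=0$. The assertion that an iterate $S_{\pm1}^{N}(x)$ lies in a given interval includes that all intermediate iterates $x,S_{\pm1}(x),\dots,S_{\pm1}^{N-1}(x)$ lie in $\mathcal J'$, so that the composition is defined. *)

(* Defs.v *)
From Stdlib Require Import Reals ZArith.
From Coquelicot Require Import Coquelicot.
Open Scope R_scope.

Definition open_itv (a b : Rbar) (x : R) : Prop := Rbar_lt a x /\ Rbar_lt x b.

Definition closed_itv (a b : R) (x : R) : Prop := a <= x <= b.

Definition solution_on (D : R -> Prop) (r f : R -> R) : Prop :=
  forall x, D x ->
    ex_derive f x /\ ex_derive (Derive f) x /\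
    Derive (Derive f) x + r x * f x = 0.

Definition S_m1 (r : R -> R) (x : R) : R := x + PI / (2 * sqrt (r x)).

Definition S_p1 (r : R -> R) (x : R) : R := x - PI / (2 * sqrt (r x)).

(* [sqrt] and division are total, so the iterates of [S_m1 r] and [S_p1 r] make
   sense as Rocq terms even outside [J]; the first clause says that the partial
   map [S : J -> R] can really be applied N times starting from [x].
   For N = 0 nothing is required of [x] beyond [A x]. *)
Definition iterate_in (J : R -> Prop) (S : R -> R) (N : nat) (x : R)
    (A : R -> Prop) : Prop :=
  (forall m : nat, (m < N)%nat -> J (Nat.iter m S x)) /\ A (Nat.iter N S x).

(* Main.v *)
(** Sturm comparison on one arch of [f].  Suppose [r] decreases on [[p, q]], where
    [p], [q] are consecutive zeros of [f] and [w] is the critical point between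
    them.  Freezing [r] at [x] makes the equation oscillate faster to the right of
    [x], so comparing [f] with a sine of frequency [sqrt (r x)] gives
    [p + PI / sqrt (r p) < q], and, whenever [p < x <= w], [S_m1 r x < q].  The
    iterates therefore cannot jump over [(w, q)]; since their steps are at least
    [PI / (2 * sqrt (r p))], they must enter it.  The increasing case follows by
    reflecting the axis. *)
Require Import Defs.
From Stdlib Require Import Reals ZArith Lra Lia Ranalysis5.
From Coquelicot Require Import Coquelicot.
Open Scope R_scope.

(** The derivative is carried as a separate function [f1], so that negating or reflecting a solution
    yields its new derivative in closed form. *)
Definition arch (r f f1 : R -> R) (p q : R) : Prop :=
  forall t, p <= t <= q -> is_derive f t (f1 t) /\ is_derive f1 t (- (r t * f t)).

Definition decreasing_on (r : R -> R) (p q : R) : Prop :=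
  forall s t, p <= s -> s < t -> t <= q -> r t < r s.

(** * Sturm comparison with a sine, and iteration on a positive arch *)

Lemma MVT_open (f df : R -> R) (a b : R) :
  a < b -> (forall t, a <= t <= b -> is_derive f t (df t)) ->
  exists c, f b - f a = df c * (b - a) /\ a < c < b.
Proof.
intros hab hd; apply MVT_cor2; trivial.
now intros c hc; apply is_derive_Reals, hd.
Qed.

(* The Wronskian of [f] and [t |-> sin (om * (t - c))] is strictly increasing
   as long as both functions are positive. *)
Lemma sturm_sine (r f f1 : R -> R) (x e c om : R) :
  arch r f f1 x e -> c <= x < e -> 0 < om ->
  (forall t, x < t < e -> 0 < f t) -> (forall t, x < t < e -> r t < om * om) ->
  f e = 0 -> f1 e <= 0 ->
  0 <= f1 x * sin (om * (x - c)) - f x * (om * cos (om * (x - c))) ->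
  c + PI / om < e.
Proof.
intros ha hx hom hpos hr he h1e hW.
destruct (Rlt_le_dec (c + PI / om) e) as [h|h]; trivial.
exfalso.
(* Under the negated conclusion the sine completes no half-period before [e], so it is nonnegative
   up to there. *)
assert (hpi : forall t, t <= e -> om * (t - c) <= PI).
{ intros t ht; replace PI with (om * (PI / om)) by (field; lra).
  apply Rmult_le_compat_l; lra. }
set (W := fun t => f1 t * sin (om * (t - c)) - f t * (om * cos (om * (t - c)))).
destruct (MVT_open W
  (fun t => (om * om - r t) * (f t * sin (om * (t - c)))) x e) as [m [hm hme]].
- lra.
- intros t ht; destruct (ha t ht) as [d d1]; unfold W.
  evar_last.
  + apply (is_derive_minus (K := R_AbsRing) (V := R_NormedModule)).
    * apply (is_derive_mult f1 (fun t => sin (om * (t - c))) t (- (r t * f t)) (om * cos (om * (t - c)))).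
      exact d1. auto_derive; trivial; unfold Rminus; ring. intros; apply Rmult_comm.
    * apply (is_derive_mult f (fun t => om * cos (om * (t - c))) t (f1 t)
        (- (om * om * sin (om * (t - c))))).
      exact d. auto_derive; trivial; unfold Rminus; ring. intros; apply Rmult_comm.
  + unfold minus, plus, opp, mult; simpl; ring.
- assert (0 < sin (om * (m - c))).
  { apply sin_gt_0; [apply Rmult_lt_0_compat; lra|].
    apply Rlt_le_trans with (om * (e - c)); [|apply hpi; lra].
    apply Rmult_lt_compat_l; lra. }
  assert (0 < (om * om - r m) * (f m * sin (om * (m - c))) * (e - x)).
  { pose proof (hpos m hme); pose proof (hr m hme).
    repeat apply Rmult_lt_0_compat; lra. }
  assert (0 <= sin (om * (e - c))).
  { apply sin_ge_0; [apply Rmult_le_pos; lra|apply hpi; lra]. }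
  (* At [e] only the term with [f1 e] survives. This contradicts [0 <= W x] and the strict growth of
     [W] given by the mean value theorem. *)
  assert (W e <= 0).
  { unfold W; rewrite he.
    assert (0 <= - f1 e * sin (om * (e - c))) by (apply Rmult_le_pos; lra).
    lra. }
  unfold W in *; lra.
Qed.

(** The second derivative [- (r t * f t)] is negative inside the arch. The mean value point is
    interior, so the vanishing of [f] at the ends does no harm. *)
Lemma concave_slope (r f f1 : R -> R) (p q : R) :
  arch r f f1 p q -> (forall t, p <= t <= q -> 0 < r t) ->
  (forall t, p < t < q -> 0 < f t) ->
  forall s t, p <= s -> s < t -> t <= q -> f1 t < f1 s.
Proof.
intros ha hr hf s t hs hst ht.
destruct (MVT_open f1 (fun t => - (r t * f t)) s t hst) as [c [hc hci]].
{ intros u hu; apply ha; lra. }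
assert (0 < r c * f c * (t - s)).
{ repeat apply Rmult_lt_0_compat; [apply hr|apply hf|]; lra. }
lra.
Qed.

(** As long as the point is at most [w], one step gains at least [d] without reaching [q]. The
    number [k] bounds the steps still needed to pass [w], and the induction is on it. *)
Lemma iterate_hits (S : R -> R) (p q w d : R) (k : nat) :
  (forall x, p < x <= w -> x + d <= S x < q) -> 0 <= d ->
  forall x, p < x < q -> w < x + INR k * d ->
  exists N, iterate_in (closed_itv p q) S N x (open_itv w q).
Proof.
intros hS hd; induction k as [|k IH]; intros x hx hw.
- exists 0%nat; split; [intros m hm; lia|]; simpl in *; split; simpl; lra.
- rewrite S_INR in hw.
  destruct (Rlt_le_dec w x) as [h|h].
  + exists 0%nat; split; [intros m hm; lia|]; split; simpl; lra.
  + assert (hs := hS x (conj (proj1 hx) h)).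
    destruct (IH (S x)) as [N [hN1 hN2]]; [lra|lra|].
    exists (Datatypes.S N); split.
    * intros [|m] hm; [simpl; unfold closed_itv; lra|].
      rewrite Nat.iter_succ_r; apply hN1; lia.
    * now rewrite Nat.iter_succ_r.
Qed.

Lemma arch_iterate_pos (r f f1 : R -> R) (p w q : R) :
  arch r f f1 p q -> p < w < q ->
  f p = 0 -> f q = 0 -> f1 w = 0 -> (forall t, p < t < q -> 0 < f t) ->
  (forall t, p <= t <= q -> 0 < r t) -> decreasing_on r p q ->
  exists N, iterate_in (closed_itv p q) (S_m1 r) N (p + PI / sqrt (r p))
    (open_itv w q).
Proof.
intros ha hw hp hq h1w hpos hr hdec.
assert (hslope := concave_slope r f f1 p q ha hr hpos).
assert (h1q : f1 q <= 0) by (rewrite <- h1w; apply Rlt_le, hslope; lra).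
assert (hsq : forall x, p <= x <= q -> 0 < sqrt (r x) /\ sqrt (r x) * sqrt (r x) = r x).
{ intros x hx; assert (hrx := hr x hx); split.
  now apply sqrt_lt_R0. apply sqrt_sqrt; lra. }
assert (hPI := PI_RGT_0).
(* The sine starts at [p] together with [f], so the Wronskian vanishes there. *)
assert (hstart : p + PI / sqrt (r p) < q).
{ destruct (hsq p) as [h1 h2]; [lra|].
  apply (sturm_sine r f f1 p q p (sqrt (r p))); trivial; try lra.
  - intros t ht; rewrite h2; apply hdec; lra.
  - rewrite hp, Rminus_diag, Rmult_0_r, sin_0; lra. }
(* The sine is now shifted back by a quarter period, to start at [x - PI / (2 * om)]. It peaks at
   [x], where the Wronskian reduces to [f1 x], nonnegative because [x <= w]. Its next zero is
   exactly [S_m1 r x]. *)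
assert (hstep : forall x, p < x <= w -> S_m1 r x < q).
{ intros x hx; destruct (hsq x) as [h1 h2]; [lra|].
  set (om := sqrt (r x)) in *.
  assert (hq4 : om * (x - (x - PI / (2 * om))) = PI / 2) by (field; lra).
  assert (0 < PI / (2 * om)) by (apply Rdiv_lt_0_compat; lra).
  unfold S_m1; fold om.
  replace (x + PI / (2 * om)) with (x - PI / (2 * om) + PI / om) by (field; lra).
  apply (sturm_sine r f f1 x q); trivial; try lra.
  - intros t ht; apply ha; lra.
  - intros t ht; apply hpos; lra.
  - intros t ht; rewrite h2; apply hdec; lra.
  - rewrite hq4, sin_PI2, cos_PI2.
    assert (0 <= f1 x).
    { destruct (proj2 hx) as [h|h]; [|rewrite h; lra].
      rewrite <- h1w; apply Rlt_le, hslope; lra. }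
    lra. }
destruct (hsq p) as [h1 _]; [lra|].
(* Since [r] is largest at [p], this is a lower bound for every step taken on the arch. *)
set (d := PI / (2 * sqrt (r p))).
assert (hd : 0 < d) by (apply Rdiv_lt_0_compat; lra).
assert (hd0 : 0 < PI / sqrt (r p)) by (apply Rdiv_lt_0_compat; lra).
destruct (INR_archimed d (w - p) hd) as [k hk].
apply (iterate_hits (S_m1 r) p q w d k); try lra.
intros x hx; split; [|now apply hstep].
destruct (hsq x) as [h2 _]; [lra|].
unfold S_m1, d; apply Rplus_le_compat_l, Rmult_le_compat_l; [lra|].
apply Rinv_le_contravar; [lra|].
apply Rmult_le_compat_l; [lra|].
apply sqrt_le_1_alt, Rlt_le, hdec; lra.
Qed.

(** * Arches of either sign *)

Lemma arch_opp (r f f1 : R -> R) (p q : R) :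
  arch r f f1 p q -> arch r (fun t => - f t) (fun t => - f1 t) p q.
Proof.
intros ha t ht; destruct (ha t ht) as [d d1]; split.
- now apply (is_derive_opp f).
- replace (- (r t * - f t)) with (- - (r t * f t)) by ring.
  now apply (is_derive_opp f1).
Qed.

Lemma arch_no_sign_change (r f f1 : R -> R) (p q s t : R) :
  arch r f f1 p q -> (forall t, p < t < q -> f t <> 0) ->
  p < s -> s < t -> t < q -> 0 < f s * f t.
Proof.
intros ha hnz hps hst htq.
assert (hs := hnz s ltac:(lra)); assert (ht := hnz t ltac:(lra)).
assert (hc : forall (g g1 : R -> R), arch r g g1 p q ->
  forall u, s <= u <= t -> continuity_pt g u).
{ intros g g1 hg u hu; apply derivable_continuous_pt; exists (g1 u).
  apply is_derive_Reals, hg; lra. }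
destruct (Rlt_le_dec (f s) 0) as [h|h]; destruct (Rlt_le_dec (f t) 0) as [h'|h'].
- replace (f s * f t) with (- f s * - f t) by ring; apply Rmult_lt_0_compat; lra.
- destruct (IVT_interv f s t (hc f f1 ha)) as [u [hu hu0]]; [lra..|].
  now destruct (hnz u); [lra|].
(* [IVT_interv] expects a passage from negative to positive, so the opposite passage is treated
   through [- f]. *)
- destruct (IVT_interv _ s t (hc _ _ (arch_opp _ _ _ _ _ ha))) as [u [hu hu0]]; [lra..|].
  destruct (hnz u); lra.
- apply Rmult_lt_0_compat; lra.
Qed.

(** The equation is linear and [f] keeps the sign of [f w] on the arch, so the positive case applies
    to [f] or to [- f]. *)
Lemma arch_iterate (r f f1 : R -> R) (p w q : R) :
  arch r f f1 p q -> p < w < q ->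
  f p = 0 -> f q = 0 -> f1 w = 0 -> (forall t, p < t < q -> f t <> 0) ->
  (forall t, p <= t <= q -> 0 < r t) -> decreasing_on r p q ->
  exists N, iterate_in (closed_itv p q) (S_m1 r) N (p + PI / sqrt (r p))
    (open_itv w q).
Proof.
intros ha hw hp hq h1w hnz hr hdec.
assert (hsign : forall t, p < t < q -> 0 < f w * f t).
{ intros t ht; destruct (Rtotal_order t w) as [h|[->|h]].
  - rewrite Rmult_comm; apply (arch_no_sign_change r f f1 p q); trivial; lra.
  - now apply Rsqr_pos_lt, hnz.
  - apply (arch_no_sign_change r f f1 p q); trivial; lra. }
destruct (Rtotal_order (f w) 0) as [h|[h|h]]; [|now destruct (hnz w)|].
- apply (arch_iterate_pos r (fun t => - f t) (fun t => - f1 t)); trivial; try lra.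
  + now apply arch_opp.
  + intros t ht; specialize (hsign t ht); nra.
- apply (arch_iterate_pos r f f1); trivial.
  intros t ht; specialize (hsign t ht); nra.
Qed.

(** * Reflection of the axis *)

Lemma arch_reflect (r f f1 : R -> R) (p q : R) :
  arch r f f1 p q ->
  arch (fun t => r (- t)) (fun t => f (- t)) (fun t => - f1 (- t)) (- q) (- p).
Proof.
intros ha t ht; destruct (ha (- t)) as [d d1]; [lra|].
assert (hopp : is_derive Ropp t (-1)) by (auto_derive; trivial; ring).
split.
- evar_last; [exact (is_derive_comp f Ropp t _ _ d hopp)|].
  unfold scal; simpl; unfold mult; simpl; ring.
- evar_last; [exact (is_derive_opp _ _ _ (is_derive_comp f1 Ropp t _ _ d1 hopp))|].
  unfold scal, opp; simpl; unfold mult; simpl; ring.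
Qed.

(** The map [t |-> - t] conjugates the forward step for the reflected coefficient to the backward
    step for [r]. *)
Lemma iter_S_reflect (r : R -> R) (m : nat) (x : R) :
  Nat.iter m (S_m1 (fun t => r (- t))) (- x) = - Nat.iter m (S_p1 r) x.
Proof.
induction m as [|m IH]; simpl; trivial.
rewrite IH; unfold S_m1, S_p1; rewrite Ropp_involutive; ring.
Qed.

(** Reflection exchanges the two ends of the arch and makes the coefficient decreasing, which
    reduces the claim to [arch_iterate] on [[- q, - p]]. *)
Lemma arch_iterate_increasing (r f f1 : R -> R) (p w q : R) :
  arch r f f1 p q -> p < w < q ->
  f p = 0 -> f q = 0 -> f1 w = 0 -> (forall t, p < t < q -> f t <> 0) ->
  (forall t, p <= t <= q -> 0 < r t) ->
  (forall s t, p <= s -> s < t -> t <= q -> r s < r t) ->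
  exists N, iterate_in (closed_itv p q) (S_p1 r) N (q - PI / sqrt (r q))
    (open_itv p w).
Proof.
intros ha hw hp hq h1w hnz hr hinc.
destruct (arch_iterate (fun t => r (- t)) (fun t => f (- t))
  (fun t => - f1 (- t)) (- q) (- w) (- p)) as [N [hN1 hN2]];
  rewrite ?Ropp_involutive; trivial; try lra.
- now apply arch_reflect.
- intros t ht; apply hnz; lra.
- intros t ht; apply hr; lra.
- intros s t hs hst ht; apply hinc; lra.
- rewrite Ropp_involutive in hN1, hN2.
  replace (- q + PI / sqrt (r q)) with (- (q - PI / sqrt (r q))) in hN1, hN2 by ring.
  rewrite iter_S_reflect in hN2; destruct hN2 as [hl hr2]; simpl in hl, hr2.
  exists N; split.
  + intros m hm; specialize (hN1 m hm); rewrite iter_S_reflect in hN1.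
    unfold closed_itv in *; lra.
  + split; simpl; lra.
Qed.

(** * Mean value theorem for a derivative relative to a closed interval *)

Lemma D_in_closed_is_derive (r r' : R -> R) (a b x : R) :
  a < x < b -> D_in r r' (closed_itv a b) x -> is_derive r x (r' x).
Proof.
intros hx hd; apply is_derive_Reals; intros eps heps.
destruct (hd eps heps) as [al [hal H]].
(* Increments smaller than the distance to both ends stay in the interval, so the relative limit is
   a two-sided one. *)
assert (hm : 0 < Rmin al (Rmin (x - a) (b - x))) by (repeat apply Rmin_glb_lt; lra).
exists (mkposreal _ hm); intros h hh0 hh; simpl in hh.
assert (Rabs h < al) by (apply Rlt_le_trans with (1 := hh), Rmin_l).
assert (hh' := Rlt_le_trans _ _ _ hh (Rmin_r _ _)).
assert (Rabs h < x - a) by (apply Rlt_le_trans with (1 := hh'), Rmin_l).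
assert (Rabs h < b - x) by (apply Rlt_le_trans with (1 := hh'), Rmin_r).
assert (- h <= Rabs h) by (rewrite <- Rabs_Ropp; apply Rle_abs).
assert (h <= Rabs h) by apply Rle_abs.
specialize (H (x + h)); simpl in H; unfold Rdist in H.
replace (x + h - x) with h in H by ring.
apply H; repeat split; unfold closed_itv; lra.
Qed.

(** Two-sided derivatives are available only at interior points, which is where the mean value
    theorem uses them. At the ends it needs just the continuity of [r]. *)
Lemma D_in_MVT (r r' : R -> R) (a b s t : R) :
  (forall x, a <= x <= b -> continuous r x) ->
  (forall x, a <= x <= b -> D_in r r' (closed_itv a b) x) ->
  a <= s -> s < t -> t <= b ->
  exists c, a <= c <= b /\ r t - r s = r' c * (t - s).
Proof.
intros hc hd hs hst ht.
destruct (MVT_gen r s t r') as [c [hci h]].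
- rewrite Rmin_left, Rmax_right by lra; intros x hx.
  apply (D_in_closed_is_derive r r' a b); [lra|apply hd; lra].
- rewrite Rmin_left, Rmax_right by lra; intros x hx.
  apply continuity_pt_filterlim, hc; lra.
- rewrite Rmin_left, Rmax_right in hci by lra.
  exists c; split; [lra|exact h].
Qed.

(** * Ordering of the zeros and decomposition into arches *)

Lemma Z_chain_le (u : Z -> R) (a b : Z) :
  (forall k, (a <= k < b)%Z -> u k < u (k + 1)%Z) ->
  forall k l, (a <= k)%Z -> (k <= l)%Z -> (l <= b)%Z -> u k <= u l.
Proof.
intros hu k l hk hkl; pattern l; apply Zlt_lower_bound_ind with (z := k); trivial.
clear l hkl; intros l IH hkl hl.
destruct (Z.eq_dec k l) as [->|hne]; [lra|].
apply Rle_trans with (u (l - 1)%Z); [apply IH; lia|].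
replace l with (l - 1 + 1)%Z at 2 by ring; apply Rlt_le, hu; lia.
Qed.

Theorem lemma3p10 (a b : Rbar) (r f : R -> R)
    (n : nat) (i : Z) (z z' : Z -> R) (r' : R -> R)
    (D := open_itv a b)
    (J' := closed_itv (z' i) (z' (i + Z.of_nat n + 1)%Z))
    (hn : (1 <= n)%nat)
    (hJD : forall x, J' x -> D x)
    (hrcont : forall x, D x -> continuous r x)
    (hf : solution_on D r f)
    (hf0 : exists x, D x /\ f x <> 0)
    (hinterlace : forall k : Z, (i <= k <= i + Z.of_nat n)%Z ->
       z' k < z k < z' (k + 1)%Z)
    (hz' : forall x, J' x ->
       (Derive f x = 0 <->
        exists k : Z, (i <= k <= i + Z.of_nat n + 1)%Z /\ x = z' k))
    (hz : forall x, J' x ->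
       (f x = 0 <-> exists k : Z, (i <= k <= i + Z.of_nat n)%Z /\ x = z k))
    (hrpos : forall x, J' x -> 0 < r x)
    (hrdiff : forall x, J' x -> D_in r r' J' x) :
  ((forall x, J' x -> r' x < 0) ->
   forall k : Z, (i <= k <= i + Z.of_nat n - 1)%Z ->
   exists N : nat,
     iterate_in J' (S_m1 r) N (z k + PI / sqrt (r (z k)))
       (open_itv (z' (k + 1)%Z) (z (k + 1)%Z)))
  /\
  ((forall x, J' x -> 0 < r' x) ->
   forall j : Z, (i + 1 <= j <= i + Z.of_nat n)%Z ->
   exists N : nat,
     iterate_in J' (S_p1 r) N (z j - PI / sqrt (r (z j)))
       (open_itv (z (j - 1)%Z) (z' j))).
Proof.
assert (hz'mono : forall k l, (i <= k)%Z -> (k <= l)%Z ->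
  (l <= i + Z.of_nat n + 1)%Z -> z' k <= z' l).
{ apply Z_chain_le; intros k hk.
  destruct (hinterlace k); [lia|lra]. }
assert (hzmono : forall k l, (i <= k)%Z -> (k <= l)%Z ->
  (l <= i + Z.of_nat n)%Z -> z k <= z l).
{ apply Z_chain_le; intros k hk.
  destruct (hinterlace k); [lia|]; destruct (hinterlace (k + 1)%Z); [lia|lra]. }
assert (hJ : forall k, (i <= k <= i + Z.of_nat n - 1)%Z ->
  forall t, z k <= t <= z (k + 1)%Z -> J' t).
{ intros k hk t ht; unfold J', closed_itv.
  destruct (hinterlace k); [lia|]; destruct (hinterlace (k + 1)%Z); [lia|].
  assert (z' i <= z' k) by (apply hz'mono; lia).
  assert (z' (k + 1 + 1)%Z <= z' (i + Z.of_nat n + 1)%Z) by (apply hz'mono; lia).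
  lra. }
assert (harch : forall k, (i <= k <= i + Z.of_nat n - 1)%Z ->
  arch r f (Derive f) (z k) (z (k + 1)%Z) /\
  z k < z' (k + 1)%Z < z (k + 1)%Z /\
  f (z k) = 0 /\ f (z (k + 1)%Z) = 0 /\ Derive f (z' (k + 1)%Z) = 0 /\
  (forall t, z k < t < z (k + 1)%Z -> f t <> 0) /\
  (forall t, z k <= t <= z (k + 1)%Z -> 0 < r t)).
{ intros k hk.
  destruct (hinterlace k); [lia|]; destruct (hinterlace (k + 1)%Z); [lia|].
  repeat apply conj; try lra.
  - intros t ht; destruct (hf t) as [h1 [h2 h3]]; [now apply hJD, (hJ k)|].
    split; [now apply Derive_correct|].
    replace (- (r t * f t)) with (Derive (Derive f) t) by lra.
    now apply Derive_correct.
  - apply hz; [apply (hJ k); trivial; lra|]; exists k; split; trivial; lia.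
  - apply hz; [apply (hJ k); trivial; lra|]; exists (k + 1)%Z; split; trivial; lia.
  - apply hz'; [apply (hJ k); trivial; lra|]; exists (k + 1)%Z; split; trivial; lia.
  (* A zero strictly between would be some [z l], with [l] at most [k] or at least [k + 1].
     Monotonicity of [z] excludes both. *)
  - intros t ht h0; apply hz in h0; [|apply (hJ k); trivial; lra].
    destruct h0 as [l [hl ->]].
    destruct (Z_le_gt_dec l k) as [h|h].
    + assert (z l <= z k) by (apply hzmono; lia); lra.
    + assert (z (k + 1)%Z <= z l) by (apply hzmono; lia); lra.
  - intros t ht; now apply hrpos, (hJ k). }
(* This turns the sign of [r'] into strict monotonicity of [r] in both halves. *)
assert (hmvt : forall s t, J' s -> s < t -> J' t ->
  exists c, J' c /\ r t - r s = r' c * (t - s)).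
{ intros s t hs hst ht; unfold J', closed_itv in hs, ht.
  apply D_in_MVT; trivial; try lra.
  intros x hx; now apply hrcont, hJD. }
split; intros hr' k hk.
- destruct (harch k hk) as (h1 & h2 & h3 & h4 & h5 & h6 & h7).
  destruct (arch_iterate r f (Derive f) (z k) (z' (k + 1)%Z) (z (k + 1)%Z))
    as [N [hN1 hN2]]; trivial.
  + intros s t hs hst ht.
    destruct (hmvt s t) as [c [hc he]]; trivial; try (apply (hJ k); trivial; lra).
    specialize (hr' c hc); nra.
  (* The intermediate iterates stay in the arch, hence in [J']. *)
  + exists N; split; trivial; intros m hm; now apply (hJ k), hN1.
(* Iterating backwards from [z k] uses the arch that ends there, whose index is [k - 1]. *)
- assert (hk' : (i <= k - 1 <= i + Z.of_nat n - 1)%Z) by lia.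
  specialize (harch _ hk'); specialize (hJ _ hk').
  replace (k - 1 + 1)%Z with k in harch, hJ by ring.
  destruct harch as (h1 & h2 & h3 & h4 & h5 & h6 & h7).
  destruct (arch_iterate_increasing r f (Derive f) (z (k - 1)%Z) (z' k) (z k))
    as [N [hN1 hN2]]; trivial.
  + intros s t hs hst ht.
    destruct (hmvt s t) as [c [hc he]]; trivial; try (apply hJ; lra).
    specialize (hr' c hc); nra.
  + exists N; split; trivial; intros m hm; now apply hJ, hN1.
Qed.
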